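(* Fix the true parameter vector $\boldsymbol{\eta}=[\mathbf{p}_u^{\mathsf T},\rho,\varphi]^{\mathsf T}$, and let $\boldsymbol{\theta}=[\theta^{\mathrm{el}},\theta^{\mathrm{az}}]^{\mathsf T}$ be the corresponding angle of departure. Consider the (rank-relaxed) problem $$\min_{\mathbf{W}}\ \mathrm{PEB}(\mathbf{W};\boldsymbol{\eta})\quad\text{subject to}\quad \mathbf{W}\in\mathbb{C}^{MQ\times MQ},\ \mathbf{W}=\mathbf{W}^{\mathsf H}\succeq 0,\ \mathrm{tr}(\mathbf{W})=1,$$ where the minimum is taken over those $\mathbf{W}$ for which the Fisher information matrix $\mathbf{J}_{\boldsymbol{\eta}}(\mathbf{W})$ is invertible. Let $$\mathbf{C}_w=\left[\mathbf{c}(\boldsymbol{\theta})^{*},\ \left(\frac{\partial \mathbf{c}(\boldsymbol{\theta})}{\partial\theta^{\mathrm{el}}}\right)^{*},\ \left(\frac{\partial \mathbf{c}(\boldsymbol{\theta})}{\partial\theta^{\mathrm{az}}}\right)^{*}\right]\in\mathbb{C}^{MQ\times 3},$$ where $(\cdot)^*$ is entrywise complex conjugation. Then any optimal matrix $\mathbf{W}$ of this problem can be represented as $$\mathbf{W}=\mathbf{C}_w\,\boldsymbol{\Xi}\,\mathbf{C}_w^{\mathsf H}$$ for some positive semidefinite matrix $\boldsymbol{\Xi}\in\mathbb{C}^{3\times 3}$.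
   Context: Superscripts $\mathsf T$, $\mathsf H$ denote transpose and conjugate transpose; $j=\sqrt{-1}$; $\Re$ is the real part. Array and basis. $M=M^hM^v$, $Q$, $N_s$ are positive integers. For angles $\boldsymbol{\theta}=[\theta^{\mathrm{el}},\theta^{\mathrm{az}}]^{\mathsf T}$, $\theta^{\mathrm{el}}\in[0,\pi]$, $\theta^{\mathrm{az}}\in[-\pi,\pi)$, the array response is $\mathbf{a}(\boldsymbol{\theta})=e^{-j2\pi\omega^h\mathbf{k}(M^h)}\otimes e^{-j2\pi\omega^v\mathbf{k}(M^v)}\in\mathbb{C}^M$ (entrywise exponentials), with $\mathbf{k}(n)=[0,\dots,n-1]^{\mathsf T}$, $\omega^h=d\sin(\theta^{\mathrm{az}})\sin(\theta^{\mathrm{el}})/\lambda$, $\omega^v=d\cos(\theta^{\mathrm{el}})/\lambda$, and constants $d,\lambda>0$. $\mathbf{b}(\boldsymbol{\theta})=[b_1(\boldsymbol{\theta}),\dots,b_Q(\boldsymbol{\theta})]^{\mathsf T}$ is a vector of $Q$ differentiable complex functions, orthonormal on the unit sphere with respect to $\sin\theta^{\mathrm{el}}\,d\theta^{\mathrm{el}}d\theta^{\mathrm{az}}$. Put $\mathbf{c}(\boldsymbol{\theta})=\mathbf{a}(\boldsymbol{\theta})\otimes\mathbf{b}(\boldsymbol{\theta})\in\mathbb{C}^{MQ}$. Signal. The delay vector is $\mathbf{d}(\tau)=[1,e^{-j2\pi\Delta f\tau},\dots,e^{-j2\pi(N_s-1)\Delta f\tau}]^{\mathsf T}$ with constant $\Delta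 f>0$. Let $P,\sigma_v^2>0$ be constants. For vectors $\mathbf{w}_1,\dots,\mathbf{w}_{N_t}\in\mathbb{C}^{MQ}$ the noise-free line-of-sight received signal in transmission $t$ is $\mathbf{x}_t=\sqrt{P}\,\alpha\,\mathbf{d}(\tau)\,\mathbf{c}(\boldsymbol{\theta})^{\mathsf T}\mathbf{w}_t\in\mathbb{C}^{N_s}$, where $\alpha=\rho e^{j\varphi}$, $\rho>0$. Fisher information. The channel parameter vector is $\boldsymbol{\gamma}=[\theta^{\mathrm{el}},\theta^{\mathrm{az}},\tau,\rho,\varphi]^{\mathsf T}\in\mathbb{R}^5$, and $\mathbf{J}_{\boldsymbol{\gamma}}\in\mathbb{R}^{5\times5}$ has entries $[\mathbf{J}_{\boldsymbol{\gamma}}]_{i,k}=\frac{2}{\sigma_v^2}\sum_{t=1}^{N_t}\Re\{(\partial\mathbf{x}_t/\partial\gamma_i)^{\mathsf H}(\partial\mathbf{x}_t/\partial\gamma_k)\}$. The state vector is $\boldsymbol{\eta}=[\mathbf{p}_u^{\mathsf T},\rho,\varphi]^{\mathsf T}$ with $\mathbf{p}_u\in\mathbb{R}^3$. Here $\boldsymbol{\gamma}$ is a function of $\boldsymbol{\eta}$: with a fixed point $\mathbf{p}_b\in\mathbb{R}^3$, a fixed rotation $\mathbf{R}_b$, and $\mathbf{p}=\mathbf{R}_b^{\mathsf T}(\mathbf{p}_u-\mathbf{p}_b)$, one has $\theta^{\mathrm{el}}=\arccos(p_3/\|\mathbf{p}\|)$, $\theta^{\mathrm{az}}=\mathrm{arctan2}(p_2,p_1)$,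 $\tau=\|\mathbf{p}_u-\mathbf{p}_b\|/c_0$ ($c_0>0$ the speed of light); $\mathbf{p}_u$ is assumed to be a point where this map is differentiable. With $\mathbf{T}=\partial\boldsymbol{\gamma}^{\mathsf T}/\partial\boldsymbol{\eta}\in\mathbb{R}^{5\times5}$, set $\mathbf{J}_{\boldsymbol{\eta}}=\mathbf{T}\mathbf{J}_{\boldsymbol{\gamma}}\mathbf{T}^{\mathsf T}$, and define the position error bound $\mathrm{PEB}=\mathrm{tr}([\mathbf{J}_{\boldsymbol{\eta}}^{-1}]_{1:3,1:3})$ (trace of the upper-left $3\times3$ block of the inverse). Dependence on $\mathbf{W}$. $\mathbf{J}_{\boldsymbol{\gamma}}$, hence $\mathbf{J}_{\boldsymbol{\eta}}$ and PEB, depends on $\mathbf{w}_1,\dots,\mathbf{w}_{N_t}$ only through $\mathbf{W}=\sum_{t=1}^{N_t}\mathbf{w}_t\mathbf{w}_t^{\mathsf H}$. For positive semidefinite $\mathbf{W}$, $\mathbf{J}_{\boldsymbol{\eta}}(\mathbf{W})$ and $\mathrm{PEB}(\mathbf{W};\boldsymbol{\eta})$ denote the values obtained from any finite family $(\mathbf{w}_t)$ with $\sum_t\mathbf{w}_t\mathbf{w}_t^{\mathsf H}=\mathbf{W}$. *)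

(* Defs.v *)
From HB Require Import structures.
From mathcomp Require Import all_boot all_order all_algebra.
From mathcomp Require Import all_classical all_reals all_analysis.
From mathcomp.real_closed Require Import complex.
From mathcomp.real_closed Require mxtens.
From mathcomp Require Import spectral.

Set Implicit Arguments.
Unset Strict Implicit.
Unset Printing Implicit Defensive.

Import Order.TTheory GRing.Theory Num.Theory.
Import numFieldNormedType.Exports.

Local Open Scope classical_set_scope.
Local Open Scope complex_scope.
Local Open Scope ring_scope.
Local Open Scope sesquilinear_scope.

Definition expi {R : realType} (x : R) : R[i] := cos x +i* sin x.

(* The branch takes its values in [-pi, pi[. *)
Definition arctan2 {R : realType} (y x : R) : R :=
  if 0 < x then atan (y / x)
  else if x < 0 then (if 0 < y then atan (y / x) + pi else atan (y / x) - pi)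
  else if 0 < y then pi / 2 else if y < 0 then - (pi / 2) else 0.

(* The library norm on matrices is the sup norm. *)
Definition enorm {R : realType} {n} (p : 'rV[R]_n) : R :=
  Num.sqrt (\sum_(i < n) p 0 i ^+ 2).

(* R[i] carries no normed R-module structure, so derivatives with respect to
   real variables are taken on real and imaginary parts. *)
Definition cderive {R : realType} {V : normedModType R} {n}
    (F : V -> 'cV[R[i]]_n) (x v : V) : 'cV[R[i]]_n :=
  \col_k ('D_v (fun y => complex.Re (F y k 0)) x
            +i* 'D_v (fun y => complex.Im (F y k 0)) x).

Definition psd {R : realType} {n} (A : 'M[R[i]]_n) : Prop :=
  A = A ^t* /\ forall x : 'cV[R[i]]_n, 0 <= (x ^t* *m A *m x) 0 0.

Definition is_rotation {R : realType} (A : 'M[R]_3) : Prop :=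
  A *m A^T = 1%:M /\ \det A = 1.

(* Angles are pairs (elevation, azimuth). *)
Definition angle_domain {R : realType} : set (R * R) :=
  `[0, pi] `*` `[- pi, pi[.

(* The open domain: at its boundary only one-sided derivatives would make
   sense, and the position-to-angle map is not differentiable there. *)
Definition basis_differentiable {R : realType} {Q}
    (b : R * R -> 'cV[R[i]]_Q) : Prop :=
  forall (theta : R * R) (q : 'I_Q),
    0 < theta.1 < pi -> - pi < theta.2 < pi ->
    differentiable (fun t : R * R => complex.Re (b t q 0)) theta /\
    differentiable (fun t : R * R => complex.Im (b t q 0)) theta.

Definition basis_orthonormal {R : realType} {Q}
    (b : R * R -> 'cV[R[i]]_Q) : Prop :=
  let mu := (@lebesgue_measure R \x @lebesgue_measure R)%E in
  forall q r : 'I_Q,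
    let f (t : R * R) := b t q 0 * (b t r 0)^* * (sin t.1)%:C in
    [/\ mu.-integrable angle_domain (fun t => (complex.Re (f t))%:E),
        mu.-integrable angle_domain (fun t => (complex.Im (f t))%:E) &
        (\int[mu]_(t in angle_domain) complex.Re (f t))
          +i* (\int[mu]_(t in angle_domain) complex.Im (f t)) = (q == r)%:R].

(* The dimensions are the horizontal and vertical array sizes, the number of
   basis functions and the number of subcarriers.  Points of R^3 are rows. *)
Record system (R : realType) (Mh Mv Q Ns : nat) := System {
  spacing : R;
  wavelength : R;
  pattern_basis : R * R -> 'cV[R[i]]_Q;
  subcarrier_spacing : R;
  power : R;
  noise_var : R;
  light_speed : R;
  bs_position : 'rV[R]_3;
  bs_rotation : 'M[R]_3 }.

Section Model.
Context {R : realType} {Mh Mv Q Ns : nat}.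
Variable s : system R Mh Mv Q Ns.

Definition omega_h (theta : R * R) : R :=
  spacing s * sin theta.2 * sin theta.1 / wavelength s.

Definition omega_v (theta : R * R) : R :=
  spacing s * cos theta.1 / wavelength s.

Definition array_response (theta : R * R) : 'cV[R[i]]_(Mh * Mv) :=
  mxtens.tensmx (\col_(k < Mh) expi (- (2 * pi * omega_h theta * k%:R)))
                (\col_(k < Mv) expi (- (2 * pi * omega_v theta * k%:R))).

Definition pattern_response (theta : R * R) : 'cV[R[i]]_(Mh * Mv * Q) :=
  mxtens.tensmx (array_response theta) (pattern_basis s theta).

Definition delay_vector (tau : R) : 'cV[R[i]]_Ns :=
  \col_(k < Ns) expi (- (2 * pi * k%:R * subcarrier_spacing s * tau)).

(* Channel parameters: gamma = [elevation, azimuth, delay, rho, phi]. *)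
Definition signal (w : 'cV[R[i]]_(Mh * Mv * Q)) (gamma : 'rV[R]_5) :
    'cV[R[i]]_Ns :=
  let alpha := (gamma 0 3)%:C * expi (gamma 0 4) in
  ((Num.sqrt (power s))%:C * alpha) *:
    (delay_vector (gamma 0 2)
       *m (pattern_response (gamma 0 0, gamma 0 1))^T *m w).

Definition fim_channel (ws : seq 'cV[R[i]]_(Mh * Mv * Q)) (gamma : 'rV[R]_5) :
    'M[R]_5 :=
  \matrix_(i, k) (2 / noise_var s *
    \sum_(w <- ws) complex.Re (((cderive (signal w) gamma (delta_mx 0 i)) ^t*
                          *m cderive (signal w) gamma (delta_mx 0 k)) 0 0)).

(* States: eta = [p_u, rho, phi].  With row vectors, R_b^T (p_u - p_b) is
   (p_u - p_b) *m R_b. *)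
Definition channel_of_state (eta : 'rV[R]_5) : 'rV[R]_5 :=
  let v := lsubmx (eta : 'rV[R]_(3 + 2)) - bs_position s in
  let p := v *m bs_rotation s in
  \row_(k < 5) [:: acos (p 0 2 / enorm p); arctan2 (p 0 1) (p 0 0);
                   enorm v / light_speed s; eta 0 3; eta 0 4]`_k.

Definition departure_angle (eta : 'rV[R]_5) : R * R :=
  (channel_of_state eta 0 0, channel_of_state eta 0 1).

(* The library Jacobian acts on rows from the right: its (i, k) entry is
   d gamma_k / d eta_i. *)
Definition fim_state (ws : seq 'cV[R[i]]_(Mh * Mv * Q)) (eta : 'rV[R]_5) :
    'M[R]_5 :=
  let T := jacobian channel_of_state eta in
  T *m fim_channel ws (channel_of_state eta) *m T^T.

(* Some finite family (w_t) with \sum_t w_t w_t^H = W, which exists as soon as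
   W is psd; the choice is immaterial, since fim_channel depends on the family
   only through this sum wherever the signal is differentiable. *)
Definition beams (W : 'M[R[i]]_(Mh * Mv * Q)) :
    seq 'cV[R[i]]_(Mh * Mv * Q) :=
  xget [::] [set ws | \sum_(w <- ws) w *m w ^t* = W].

Definition FIM (W : 'M[R[i]]_(Mh * Mv * Q)) (eta : 'rV[R]_5) : 'M[R]_5 :=
  fim_state (beams W) eta.

Definition PEB (W : 'M[R[i]]_(Mh * Mv * Q)) (eta : 'rV[R]_5) : R :=
  \tr (ulsubmx (invmx (FIM W eta) : 'M[R]_(3 + 2))).

Definition feasible (eta : 'rV[R]_5) (W : 'M[R[i]]_(Mh * Mv * Q)) : Prop :=
  [/\ psd W, \tr W = 1 & FIM W eta \in unitmx].

Definition optimal (eta : 'rV[R]_5) (W : 'M[R[i]]_(Mh * Mv * Q)) : Prop :=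
  feasible eta W /\
  forall W' : 'M[R[i]]_(Mh * Mv * Q), feasible eta W' -> PEB W eta <= PEB W' eta.

Definition C_w (theta : R * R) : 'M[R[i]]_(Mh * Mv * Q, 3) :=
  map_mx Num.conj
    (row_mx (pattern_response theta)
      (row_mx (cderive pattern_response theta (1, 0))
              (cderive pattern_response theta (0, 1)))).

End Model.

(* Main.v *)
Require Import Defs.
From HB Require Import structures.
From mathcomp Require Import all_boot all_order all_algebra.
From mathcomp Require Import all_classical all_reals all_analysis.
From mathcomp.real_closed Require Import complex.
From mathcomp Require Import spectral.
From mathcomp Require Import ring lra.
From mathcomp.real_closed Require mxtens.

Import Order.TTheory GRing.Theory Num.Theory.
Import numFieldNormedType.Exports.

Local Open Scope classical_set_scope.
Local Open Scope complex_scope.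
Local Open Scope ring_scope.
Local Open Scope sesquilinear_scope.

(* Split every beam as [w = C x + y] with [C = C_w] and [C^H y = 0].  The Fisher
   information depends on [w] only through [C^H w], because every partial
   derivative of the signal is a fixed matrix applied to [C^H w]; so the beams
   [C x] give the same information with trace [t <= 1].  If some [y] is nonzero,
   then [t < 1], and rescaling the beams [C x] to trace [1] multiplies the Fisher
   information by [1 / t] and the error bound, which is positive, by [t],
   contradicting optimality.  Hence [W] is the sum of the [C x x^H C^H].  The
   response [c] can be differentiated at the true angles, because these lie in
   the open domain wherever the position-to-angle map is differentiable. *)

(** * Gram matrices and orthogonal decomposition *)

Lemma adjmxM {C : numClosedFieldType} m n p (A : 'M[C]_(m, n)) (B : 'M[C]_(n, p)) :
  (A *m B) ^t* = B ^t* *m A ^t*.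
Proof. by rewrite trmx_mul map_mxM. Qed.

Lemma adjmxE {C : numClosedFieldType} m n (A : 'M[C]_(m, n)) i j :
  (A ^t*) i j = (A j i)^*.
Proof. by rewrite !mxE. Qed.

Lemma trmx_gram {C : numClosedFieldType} m n (A : 'M[C]_(m, n)) :
  \tr (A *m A ^t*) = \sum_i \sum_j `|A i j| ^+ 2.
Proof.
rewrite /mxtrace; apply: eq_bigr => i _; rewrite !mxE; apply: eq_bigr => j _.
by rewrite adjmxE normCK.
Qed.

Lemma trmx_gram_ge0 {C : numClosedFieldType} m n (A : 'M[C]_(m, n)) :
  0 <= \tr (A *m A ^t*).
Proof.
by rewrite trmx_gram; apply: sumr_ge0 => i _; apply: sumr_ge0 => j _; rewrite exprn_ge0.
Qed.

Lemma trmx_gram_eq0 {C : numClosedFieldType} m n (A : 'M[C]_(m, n)) :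
  \tr (A *m A ^t*) = 0 -> A = 0.
Proof.
have sq_ge0 i j : 0 <= `|A i j| ^+ 2 by rewrite exprn_ge0.
rewrite trmx_gram => /eqP; rewrite psumr_eq0 => [/allP A0|i _]; last first.
  by apply: sumr_ge0 => j _.
apply/matrixP => i j; rewrite mxE.
have := A0 i (mem_index_enum i); rewrite psumr_eq0 // => /allP /(_ j (mem_index_enum j)).
by rewrite /= expf_eq0 normr_eq0 => /eqP.
Qed.

Lemma gram_eq0 {C : numClosedFieldType} m n (A : 'M[C]_(m, n)) :
  A *m A ^t* = 0 -> A = 0.
Proof. by move=> A0; apply: trmx_gram_eq0; rewrite A0 mxtrace0. Qed.

(** The coefficient [x] solves the normal equations [A^H A x = A^H w]. They are solvable because
    [A^H A] and [A] have the same kernel: if [A^H A N = 0], then [(A N)^H (A N) = 0], so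
    [A N = 0]. *)
Lemma orthogonal_decomposition {C : numClosedFieldType} m n p
    (A : 'M[C]_(m, n)) (w : 'M[C]_(m, p)) :
  exists x y, w = A *m x + y /\ A ^t* *m y = 0.
Proof.
suff /submxP[z wE] : (w ^t* *m A <= A ^t* *m A)%MS.
  exists (z ^t*), (w - A *m z ^t*); split; first by rewrite addrC subrK.
  rewrite mulmxBr; apply/eqP; rewrite subr_eq0; apply/eqP.
  by move/(congr1 (fun M => M ^t*)): wE; rewrite !adjmxM !trmxCK mulmxA.
rewrite submxE.
set N := cokermx _.
rewrite -mulmxA; suff -> : A *m N = 0 by rewrite mulmx0.
have AN : A ^t* *m A *m N = 0 by rewrite mulmx_coker.
have /(congr1 (fun M => M ^t*)) : (A *m N) ^t* = 0.
  by apply: gram_eq0; rewrite trmxCK adjmxM -mulmxA (mulmxA _ A) AN mulmx0.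
by rewrite trmxCK => ->; rewrite trmx0 map_mx0.
Qed.

(** * Derivatives of complex-valued functions of real variables *)

Definition cdifferentiable {R : realType} {V : normedModType R}
    (F : V -> R[i]) (x : V) : Prop :=
  differentiable (fun y => complex.Re (F y)) x /\
  differentiable (fun y => complex.Im (F y)) x.

Definition cder {R : realType} {V : normedModType R}
    (F : V -> R[i]) (x v : V) : R[i] :=
  'D_v (fun y => complex.Re (F y)) x +i* 'D_v (fun y => complex.Im (F y)) x.

Section ComplexDerivative.
Context {R : realType} {V : normedModType R}.
Implicit Types (F G : V -> R[i]) (x v : V).

Lemma cdifferentiable_cst (a : R[i]) x : cdifferentiable (fun=> a) x.
Proof. by split; apply: differentiable_cst. Qed.

Lemma cdifferentiable_real (f : V -> R) x :
  differentiable f x -> cdifferentiable (fun y => (f y)%:C) x.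
Proof. by move=> df; split => //=; apply: differentiable_cst. Qed.

Lemma cdifferentiableD F G x : cdifferentiable F x -> cdifferentiable G x ->
  cdifferentiable (fun y => F y + G y) x.
Proof.
move=> [F1 F2] [G1 G2]; split.
- under eq_fun do rewrite raddfD /=.
  exact: differentiableD.
- under eq_fun do rewrite raddfD /=.
  exact: differentiableD.
Qed.

Lemma ReM (a b : R[i]) :
  complex.Re (a * b) = complex.Re a * complex.Re b - complex.Im a * complex.Im b.
Proof. by case: a b => [a1 a2] [b1 b2]. Qed.

Lemma ImM (a b : R[i]) :
  complex.Im (a * b) = complex.Re a * complex.Im b + complex.Im a * complex.Re b.
Proof. by case: a b => [a1 a2] [b1 b2]. Qed.

Lemma cdifferentiableM F G x : cdifferentiable F x -> cdifferentiable G x ->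
  cdifferentiable (fun y => F y * G y) x.
Proof.
move=> [F1 F2] [G1 G2]; split.
- under eq_fun do rewrite ReM.
  by apply: differentiableB; apply: differentiableM.
- under eq_fun do rewrite ImM.
  by apply: differentiableD; apply: differentiableM.
Qed.

Lemma cdifferentiable_expi (f : V -> R) x :
  differentiable f x -> cdifferentiable (fun y => expi (f y)) x.
Proof.
move=> df; split => /=.
- apply: (@differentiable_comp _ _ _ _ f cos) => //.
  exact/derivable1_diffP/derivable_cos.
- apply: (@differentiable_comp _ _ _ _ f sin) => //.
  exact/derivable1_diffP/derivable_sin.
Qed.

Lemma cderD F G x v : cdifferentiable F x -> cdifferentiable G x ->
  cder (fun y => F y + G y) x v = cder F x v + cder G x v.
Proof.
move=> [F1 F2] [G1 G2]; rewrite /cder.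
have -> : (fun y => complex.Re (F y + G y)) =
  (fun y => complex.Re (F y)) + (fun y => complex.Re (G y)).
  by apply/funext => y; rewrite raddfD.
have -> : (fun y => complex.Im (F y + G y)) =
  (fun y => complex.Im (F y)) + (fun y => complex.Im (G y)).
  by apply/funext => y; rewrite raddfD.
by rewrite !deriveD //; apply: diff_derivable.
Qed.

Lemma cderZ (a : R[i]) F x v : cdifferentiable F x ->
  cder (fun y => a * F y) x v = a * cder F x v.
Proof.
move=> [F1 F2]; rewrite /cder.
have D1 := diff_derivable F1; have D2 := diff_derivable F2.
have -> : (fun y => complex.Re (a * F y)) =
  (complex.Re a \*: (fun y => complex.Re (F y))) -
  (complex.Im a \*: (fun y => complex.Im (F y))).
  by apply/funext => y; rewrite ReM.
have -> : (fun y => complex.Im (a * F y)) =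
  (complex.Re a \*: (fun y => complex.Im (F y))) +
  (complex.Im a \*: (fun y => complex.Re (F y))).
  by apply/funext => y; rewrite ImM.
rewrite deriveB ?deriveD; try by apply: derivableZ.
rewrite !deriveZ //.
by case: a.
Qed.

Lemma cder_cst (a : R[i]) x v : cder (fun=> a) x v = 0.
Proof. by rewrite /cder !derive_cst. Qed.

Lemma cdifferentiable_sum (I : Type) (r : seq I) (F : I -> V -> R[i]) x :
  (forall i, cdifferentiable (F i) x) ->
  cdifferentiable (fun y => \sum_(i <- r) F i y) x.
Proof.
move=> dF; elim: r => [|i r IHr].
  by under eq_fun do rewrite big_nil; apply: cdifferentiable_cst.
by under eq_fun do rewrite big_cons; apply: cdifferentiableD.
Qed.

Lemma cder_sum (I : Type) (r : seq I) (F : I -> V -> R[i]) x v :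
  (forall i, cdifferentiable (F i) x) ->
  cder (fun y => \sum_(i <- r) F i y) x v = \sum_(i <- r) cder (F i) x v.
Proof.
move=> dF; elim: r => [|i r IHr].
  by under eq_fun do rewrite big_nil; rewrite big_nil cder_cst.
under eq_fun do rewrite big_cons.
by rewrite cderD // ?IHr ?big_cons//; apply: cdifferentiable_sum.
Qed.

Lemma cderiveE n (F : V -> 'cV[R[i]]_n) x v k :
  cderive F x v k 0 = cder (fun y => F y k 0) x v.
Proof. by rewrite mxE. Qed.

(** A directional derivative sees only the values along one line. This carries partial derivatives
    in the five channel parameters over to derivatives in the angle plane, and freezes the factors
    that are constant along the line. *)
Lemma derive_line {V' : normedModType R} (f : V -> R) (g : V' -> R) x v (x' v' : V') :
  (forall h : R, f (h *: v + x) = g (h *: v' + x')) -> 'D_v f x = 'D_v' g x'.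
Proof.
move=> fg; rewrite /derive.
have fg0 : f x = g x' by have := fg 0; rewrite !scale0r !add0r.
suff -> : (fun h : R => h^-1 *: ((f \o shift x) (h *: v) - f x)) =
  (fun h : R => h^-1 *: ((g \o shift x') (h *: v') - g x')) by [].
by apply/funext => h /=; rewrite fg fg0.
Qed.

Lemma cder_line {V' : normedModType R} F (G : V' -> R[i]) x v (x' v' : V') :
  (forall h : R, F (h *: v + x) = G (h *: v' + x')) ->
  cder F x v = cder G x' v'.
Proof.
by move=> FG; congr (_ +i* _); apply: derive_line => h; rewrite FG.
Qed.

End ComplexDerivative.

Lemma differentiable_fst {R : realType} {V W : normedModType R} (x : V * W) :
  differentiable fst x.
Proof. by apply: linear_differentiable => y; exact: cvg_fst. Qed.

Lemma differentiable_snd {R : realType} {V W : normedModType R} (x : V * W) :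
  differentiable snd x.
Proof. by apply: linear_differentiable => y; exact: cvg_snd. Qed.

(** * Real Gram matrices and inverses of positive semidefinite matrices *)

(** Abstract shape of the channel Fisher information: [r] is the family of beams and [D w i] the
    [i]-th partial derivative of the signal sent with beam [w]. *)
Definition re_gram {R : realType} {n N} {T : Type} (a : R) (r : seq T)
    (D : T -> 'I_n -> 'cV[R[i]]_N) : 'M[R]_n :=
  \matrix_(i, k) (a * \sum_(w <- r) complex.Re (((D w i) ^t* *m D w k) 0 0)).

Section ReGram.
Context {R : realType} {n N : nat} {T : Type}.
Variables (a : R) (r : seq T) (D : T -> 'I_n -> 'cV[R[i]]_N).

Lemma re_gramE i k : re_gram a r D i k =
  a * \sum_(w <- r) complex.Re (\tr (D w k *m (D w i) ^t*)).
Proof.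
rewrite mxE; congr (_ * _); apply: eq_bigr => w _.
by rewrite -trace_mx11 mxtrace_mulC.
Qed.

Lemma re_gram_sym : (re_gram a r D)^T = re_gram a r D.
Proof.
apply/matrixP => i k; rewrite [LHS]mxE !re_gramE; congr (_ * _).
apply: eq_bigr => w _.
have <- : (D w k *m (D w i) ^t*) ^t* = D w i *m (D w k) ^t*.
  by rewrite adjmxM trmxCK.
by rewrite trace_map_mx mxtrace_tr; case: (\tr _).
Qed.

(** Since [y] is real, it can be moved inside the real part, which turns the form into [a] times a
    sum of squared norms of the vectors [Y w]. *)
Lemma re_gram_ge0 (y : 'rV[R]_n) :
  0 <= a -> 0 <= (y *m re_gram a r D *m y^T) 0 0.
Proof.
move=> a0; pose Y w := \sum_i (y 0 i)%:C *: D w i.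
suff -> : (y *m re_gram a r D *m y^T) 0 0 =
    a * \sum_(w <- r) complex.Re (\tr (Y w *m (Y w) ^t*)).
  rewrite mulr_ge0 // sumr_ge0 // => w _.
  by have := trmx_gram_ge0 _ _ (Y w); rewrite lecE => /andP[].
transitivity (\sum_k \sum_i \sum_(w <- r) a * (y 0 i * y 0 k *
    complex.Re (\tr (D w k *m (D w i) ^t*)))).
  rewrite mxE; apply: eq_bigr => k _; rewrite mxE mulr_suml; apply: eq_bigr => i _.
  rewrite re_gramE [y^T k 0]mxE !mulr_sumr mulr_suml; apply: eq_bigr => w _.
  by ring.
under eq_bigr do rewrite exchange_big /=.
rewrite exchange_big /= mulr_sumr; apply: eq_bigr => w _.
under eq_bigr do rewrite -mulr_sumr.
rewrite -mulr_sumr; congr (_ * _).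
rewrite {1}/Y mulmx_suml [\tr _]raddf_sum raddf_sum /=; apply: eq_bigr => k _.
have -> : (Y w) ^t* = \sum_i (y 0 i)%:C *: (D w i) ^t*.
  apply/matrixP => p q; rewrite adjmxE !summxE rmorph_sum; apply: eq_bigr => i _.
  rewrite !mxE rmorphM; congr (_ * _).
  by apply: conj_Creal; apply/complex_realP; exists (y 0 i).
rewrite mulmx_sumr [\tr _]raddf_sum raddf_sum /=.
apply: eq_bigr => i _.
rewrite -scalemxAl -scalemxAr !mxtraceZ !ReM /=.
by rewrite !mul0r !subr0; ring.
Qed.

(** By linearity of the trace, the sum over [w] can be taken inside, so the family enters only
    through the sum of the [v w (v w)^H]. *)
Lemma re_gram_factor m (Z : 'I_n -> 'M[R[i]]_(N, m)) (v : T -> 'cV[R[i]]_m) :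
  (forall w i, D w i = Z i *m v w) ->
  re_gram a r D = \matrix_(i, k)
    (a * complex.Re (\tr (Z k *m (\sum_(w <- r) v w *m (v w) ^t*) *m (Z i) ^t*))).
Proof.
move=> dZ; apply/matrixP => i k; rewrite re_gramE mxE; congr (_ * _).
rewrite mulmx_sumr mulmx_suml [\tr _]raddf_sum raddf_sum /=.
by apply: eq_bigr => w _; rewrite !dZ adjmxM !mulmxA.
Qed.

Lemma re_gram_nil : re_gram a [::] D = 0.
Proof. by apply/matrixP => i k; rewrite !mxE big_nil mulr0. Qed.

End ReGram.

(** The form evaluated at row [i] of the inverse is the diagonal entry itself, hence nonnegative;
    excluding zero takes a perturbation of that row. This yields the positivity of the error
    bound. *)
Lemma invmx_diag_gt0 {R : realFieldType} n (J : 'M[R]_n) i :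
  J \in unitmx -> J^T = J -> (forall y : 'rV_n, 0 <= (y *m J *m y^T) 0 0) ->
  0 < invmx J i i.
Proof.
move=> uJ symJ psdJ; set K := invmx J.
have KJ : row i K *m J = delta_mx 0 i by rewrite -row_mul mulVmx // row1.
have JK : J *m (row i K)^T = delta_mx i 0.
  by apply: trmx_inj; rewrite trmx_mul trmxK symJ KJ trmx_delta.
have entry (y : 'rV[R]_n) : (y *m delta_mx i (0 : 'I_1)) 0 0 = y 0 i.
  by rewrite -colE mxE.
have Kii : (row i K *m J *m (row i K)^T) 0 0 = K i i by rewrite -mulmxA JK entry mxE.
have K0 : 0 <= K i i by rewrite -Kii.
rewrite lt_neqAle K0 andbT; apply/negP => /eqP Ki0.
(* If [K i i = 0], the form at [a *: row i K + e] is affine in [a], namely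
   [2 a + J i i], so it takes a negative value. *)
pose a : R := - ((J i i + 1) / 2).
pose e : 'rV[R]_n := delta_mx 0 i.
have := psdJ (a *: row i K + e).
suff -> : ((a *: row i K + e) *m J *m (a *: row i K + e)^T) 0 0 = a + (a + J i i).
  by rewrite /a; move: (J i i); clear=> j; lra.
have ee : e 0 i = 1 by rewrite mxE !eqxx.
have eKe : (e *m (row i K)^T) 0 0 = 0 by rewrite -rowE !mxE -Ki0.
have eee : (e *m e^T) 0 0 = 1 by rewrite /e trmx_delta entry ee.
have eJe : (e *m J *m e^T) 0 0 = J i i by rewrite /e trmx_delta entry -rowE mxE.
have addE (A B : 'M[R]_1) : (A + B) 0 0 = A 0 0 + B 0 0 by rewrite mxE.
have scaleE b (A : 'M[R]_1) : (b *: A) 0 0 = b * A 0 0 by rewrite mxE.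
rewrite linearD linearZ /= mulmxDl -scalemxAl KJ -/e mulmxDl !mulmxDr.
rewrite -!scalemxAr -!scalemxAl -[e *m J *m (row i K)^T]mulmxA JK.
by rewrite !(addE, scaleE) eKe eee eJe entry ee !mulr0 add0r mulr1.
Qed.

(** * Ranges of the two angles *)

(** On the cut the value is [- pi], or [0] at the origin; just above it, [atan] exceeds [- (pi / 2)]
    and is shifted by [pi], or the value is [pi / 2]. *)
Lemma arctan2_jump {R : realType} (x h : R) :
  x <= 0 -> 0 < h -> arctan2 0 x <= 0 /\ pi / 2 <= arctan2 h x.
Proof.
have pi0 := pi_gt0 R.
rewrite /arctan2 !ltxx mul0r atan0 sub0r => x0 h0; rewrite h0 ltNge x0 /=.
case: ltP => [xneg|_]; split; rewrite ?oppr_le0 ?lexx// ?ltW//.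
by have := atan_gtNpi2 (h / x); lra.
Qed.

(** For [x < 0] the value [- pi] occurs only at [y = 0]; otherwise the sign of [y / x] gives [atan]
    a strict sign, which keeps the shifted value strictly inside. *)
Lemma arctan2_interior {R : realType} (y x : R) :
  ~ (y = 0 /\ x <= 0) -> - pi < arctan2 y x < pi.
Proof.
move=> yx; have pi0 := pi_gt0 R; rewrite /arctan2.
have a1 := atan_gtNpi2 (y / x); have a2 := atan_ltpi2 (y / x).
case: (ltP 0 x) => x0; first by apply/andP; split; lra.
have yn0 : y != 0 by apply/eqP => y0; apply: yx.
case: (ltP x 0) => x1.
  case: (ltP 0 y) => y0.
    have : atan (y / x) < atan 0 by rewrite lt_atan// pmulr_rlt0// invr_lt0.
    by rewrite atan0 => ?; apply/andP; split; lra.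
  have y1 : y < 0 by rewrite lt_neqAle yn0.
  have : atan 0 < atan (y / x) by rewrite lt_atan// nmulr_rgt0// invr_lt0.
  by rewrite atan0 => ?; apply/andP; split; lra.
by case: (ltP 0 y) => y0; last case: (ltP y 0) => y1; apply/andP; split; lra.
Qed.

(** The hypothesis excludes the vertical axis, so [p 0 2] is strictly smaller in absolute value than
    the norm. *)
Lemma acos_interior {R : realType} (p : 'rV[R]_3) :
  ~ (p 0 1 = 0 /\ p 0 0 <= 0) -> 0 < acos (p 0 2 / enorm p) < pi.
Proof.
move=> pn0.
set S := \sum_(i < 3) p 0 i ^+ 2.
have SE : S = p 0 0 ^+ 2 + p 0 1 ^+ 2 + p 0 2 ^+ 2.
  rewrite /S !big_ord_recl big_ord0 addr0 addrA.
  by congr (_ ^+ 2 + _ ^+ 2 + _ ^+ 2); congr (p _ _); apply: val_inj.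
have p01 : 0 < p 0 0 ^+ 2 + p 0 1 ^+ 2.
  rewrite lt_neqAle addr_ge0 ?sqr_ge0// andbT eq_sym paddr_eq0 ?sqr_ge0// !sqrf_eq0.
  by apply/negP => /andP[/eqP p0 /eqP p1]; apply: pn0; rewrite p0 p1.
have p2S : p 0 2 ^+ 2 < S by rewrite SE; lra.
have S0 : 0 < S by apply: le_lt_trans p2S; exact: sqr_ge0.
have : `|p 0 2 / enorm p| < 1.
  rewrite /enorm -/S normrM normfV (ger0_norm (sqrtr_ge0 _)) ltr_pdivrMr ?sqrtr_gt0//.
  by rewrite mul1r -sqrtr_sqr ltr_sqrt.
rewrite ltr_norml => /andP[m1 m2].
by rewrite acos_gt0 ?acos_ltpi ?m1 ?m2 ?(ltW m1) ?(ltW m2).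
Qed.

(** * The departure angle lies in the open domain *)

Section Model.
Context {R : realType} {Mh Mv Q Ns : nat}.
Variable s : system R Mh Mv Q Ns.

(* If the target lay on the cut of the azimuth, moving it in the direction of
   increasing [p_2] would make [arctan2] jump. *)
Lemma departure_angle_interior (eta : 'rV[R]_5) :
  is_rotation (bs_rotation s) -> differentiable (channel_of_state s) eta ->
  0 < (departure_angle s eta).1 < pi /\ - pi < (departure_angle s eta).2 < pi.
Proof.
move=> [rot _] dchan.
set p := (lsubmx (eta : 'rV[R]_(3 + 2)) - bs_position s) *m bs_rotation s.
suff pn0 : ~ (p 0 1 = 0 /\ p 0 0 <= 0).
  have cE k : channel_of_state s eta 0 k = [:: acos (p 0 2 / enorm p);
    arctan2 (p 0 1) (p 0 0); enorm (lsubmx (eta : 'rV[R]_(3 + 2)) - bs_position s) /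
    light_speed s; eta 0 3; eta 0 4]`_k by rewrite mxE.
  rewrite /departure_angle !cE /=; split.
    exact: acos_interior.
  exact: arctan2_interior.
move=> [p1 p0].
(* The direction is chosen so that the rotation takes it to the second local axis: moving the state
   by [h *: d] changes [p] by [h] in that coordinate alone. *)
pose d : 'rV[R]_5 := row_mx (delta_mx 0 1 *m (bs_rotation s)^T) (0 : 'rV[R]_2).
pose g (h : R) := channel_of_state s (eta + h *: d) 0 1.
have gE h : g h = arctan2 h (p 0 0).
  rewrite /g /channel_of_state mxE /=.
  have -> : (lsubmx (eta + h *: d : 'rV[R]_(3 + 2)) - bs_position s) *m bs_rotation s
      = p + h *: delta_mx 0 1.
    rewrite linearD linearZ /= /d row_mxKl addrAC mulmxDl -scalemxAl -mulmxA.
    by rewrite (mulmx1C rot) mulmx1.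
  by clearbody p; rewrite !mxE p1 add0r /= mulr1 mulr0 addr0.
have gcont : {for 0, continuous g}.
  have c1 : {for 0, continuous (fun h : R => eta + h *: d)}.
    by apply: cvgD; [exact: cvg_cst | apply: cvgZr_tmp; exact: cvg_id].
  have c2 : {for eta + 0 *: d, continuous (channel_of_state s)}.
    by rewrite scale0r addr0; exact: differentiable_continuous.
  have c3 := continuous_comp c1 c2.
  exact: (continuous_comp c3 (@coord_continuous _ _ _ 0 1 _)).
have pi0 := pi_gt0 R.
have /gcont : \forall y \near g 0, y < pi / 2.
  apply: (lt_nbhsl (_ : g 0 < pi / 2)).
  by have [] := arctan2_jump _ _ p0 ltr01; rewrite gE; lra.
move=> /nbhs_ballP[e /= e0 ge].
have e2 : 0 < e / 2 by rewrite divr_gt0.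
have /ge : ball (0 : R) e (e / 2) by rewrite /ball /= sub0r normrN gtr0_norm //; lra.
by rewrite /= gE ltNge; have [_ ->] := arctan2_jump _ _ p0 e2.
Qed.

(** * Partial derivatives of the signal *)

Lemma pattern_responseE (theta : R * R) k :
  pattern_response s theta k 0 =
  expi (- (2 * pi * omega_h s theta *
    (mxtens.mxtens_unindex (mxtens.mxtens_unindex k).1).1%:R)) *
  expi (- (2 * pi * omega_v s theta *
    (mxtens.mxtens_unindex (mxtens.mxtens_unindex k).1).2%:R)) *
  pattern_basis s theta (mxtens.mxtens_unindex k).2 0.
Proof. by rewrite !mxE; congr (_ * pattern_basis s theta _ _); rewrite [LHS]ord1. Qed.

Lemma pattern_response_cdifferentiable (theta : R * R) k :
  basis_differentiable (pattern_basis s) ->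
  0 < theta.1 < pi -> - pi < theta.2 < pi ->
  cdifferentiable (fun t => pattern_response s t k 0) theta.
Proof.
move=> db el az; under eq_fun do rewrite pattern_responseE.
have dcos : differentiable (fun t : R * R => cos t.1) theta.
  apply: (@differentiable_comp _ _ _ _ fst cos); first exact: differentiable_fst.
  exact/derivable1_diffP/derivable_cos.
have dsin : differentiable (fun t : R * R => sin t.1) theta.
  apply: (@differentiable_comp _ _ _ _ fst sin); first exact: differentiable_fst.
  exact/derivable1_diffP/derivable_sin.
have dsin2 : differentiable (fun t : R * R => sin t.2) theta.
  apply: (@differentiable_comp _ _ _ _ snd sin); first exact: differentiable_snd.
  exact/derivable1_diffP/derivable_sin.
have dZ (a : R) (f : R * R -> R) : differentiable f theta ->
    differentiable (fun t => a * f t) theta.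
  by move=> df; apply: differentiableM => //; exact: differentiable_cst.
apply: cdifferentiableM; last exact: db.
apply: cdifferentiableM; apply: cdifferentiable_expi.
- set j := (_.1 : 'I_Mh).
  under eq_fun => t.
    rewrite (_ : - _ = - (2 * pi * (spacing s / wavelength s) * j%:R) *
      (sin t.2 * sin t.1)); last by rewrite /omega_h; ring.
    over.
  exact/dZ/differentiableM.
- set j := (_.2 : 'I_Mv).
  under eq_fun => t.
    rewrite (_ : - _ = - (2 * pi * (spacing s / wavelength s) * j%:R) * cos t.1);
      last by rewrite /omega_v; ring.
    over.
  exact/dZ.
Qed.

(** The part of the [k]-th sample that depends on delay and gain only; the angles and the beam enter
    through the other factor, the scalar [c^T w]. *)
Definition signal_factor (k : 'I_Ns) (gamma : 'rV[R]_5) : R[i] :=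
  (Num.sqrt (power s))%:C * ((gamma 0 3)%:C * expi (gamma 0 4)) *
  delay_vector s (gamma 0 2) k 0.

Lemma signalE w gamma k :
  signal s w gamma k 0 = signal_factor k gamma *
  \sum_m w m 0 * pattern_response s (gamma 0 0, gamma 0 1) m 0.
Proof.
rewrite /signal /signal_factor mxE -[RHS]mulrA -mulmxA; congr (_ * _).
rewrite mxE big_ord1; congr (_ * _).
by rewrite mxE; apply: eq_bigr => m _; rewrite mxE mulrC.
Qed.

Lemma signal_factor_cdifferentiable k gamma :
  cdifferentiable (signal_factor k) gamma.
Proof.
rewrite /signal_factor.
have dg i : differentiable (fun y : 'rV[R]_5 => y 0 i) gamma.
  exact: differentiable_coord.
apply: cdifferentiableM.
  apply: cdifferentiableM; first exact: cdifferentiable_cst.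
  apply: cdifferentiableM; first exact: cdifferentiable_real.
  exact: cdifferentiable_expi.
rewrite /delay_vector.
under eq_fun do rewrite mxE.
apply: cdifferentiable_expi; apply: differentiableN.
by apply: differentiableM => //; exact: differentiable_cst.
Qed.

(** The conjugation in [C_w] cancels that of the adjoint, so [C_w^H w] collects [c^T w] and its two
    angular derivatives. *)
Lemma adj_C_w_mul (theta : R * R) (w : 'cV[R[i]]_(Mh * Mv * Q)) (j : 'I_3) :
  ((C_w s theta) ^t* *m w) j 0 =
  \sum_m w m 0 * [:: pattern_response s theta m 0;
    cderive (pattern_response s) theta (1, 0) m 0;
    cderive (pattern_response s) theta (0, 1) m 0]`_j.
Proof.
rewrite mxE; apply: eq_bigr => m _; rewrite mulrC; congr (_ * _).
rewrite adjmxE /C_w mxE conjCK.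
case: j => -[|[|[|//]]] Hj /=.
- have -> : Ordinal Hj = lshift 2 (0 : 'I_1) by apply: val_inj.
  by rewrite row_mxEl.
- have -> : Ordinal Hj = rshift 1 (lshift 1 (0 : 'I_1)) by apply: val_inj.
  by rewrite row_mxEr row_mxEl.
- have -> : Ordinal Hj = rshift 1 (rshift 1 (0 : 'I_1)) by apply: val_inj.
  by rewrite row_mxEr row_mxEr.
Qed.

(** The angles and the other parameters sit in separate factors of the signal, so each partial
    derivative is a multiple of a single coordinate of [C_w^H w]. *)
Lemma cderive_signal (gamma : 'rV[R]_5) :
  basis_differentiable (pattern_basis s) ->
  0 < gamma 0 0 < pi -> - pi < gamma 0 1 < pi ->
  exists Z : 'I_5 -> 'M[R[i]]_(Ns, 3), forall w i,
    cderive (signal s w) gamma (delta_mx 0 i) =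
    Z i *m ((C_w s (gamma 0 0, gamma 0 1)) ^t* *m w).
Proof.
move=> db el az.
(* [c i] is the coordinate selected by parameter [i] and [z i k] its coefficient: the angles [0] and
   [1] select the derivative columns [1] and [2], all other parameters select column [0]. *)
pose z (i : 'I_5) (k : 'I_Ns) := if (i < 2)%N then signal_factor k gamma
  else cder (signal_factor k) gamma (delta_mx 0 i).
pose c (i : 'I_5) : 'I_3 := if (i < 2)%N then inord i.+1 else 0.
exists (fun i => \matrix_(k, j) (z i k * (j == c i)%:R)) => w i.
apply/colP => k; rewrite cderiveE [RHS]mxE (bigD1 (c i)) //= big1 ?addr0; last first.
  by move=> j jc; rewrite mxE (negbTE jc) mulr0 mul0r.
rewrite mxE eqxx mulr1 adj_C_w_mul.
under eq_fun do rewrite signalE.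
set th := (gamma 0 0, gamma 0 1).
have dc m : cdifferentiable (fun t => pattern_response s t m 0) th.
  exact: pattern_response_cdifferentiable.
have dcw m : cdifferentiable (fun t => w m 0 * pattern_response s t m 0) th.
  by apply: cdifferentiableM => //; exact: cdifferentiable_cst.
have angle (v : R * R) : cder (fun t => signal_factor k gamma *
    \sum_m w m 0 * pattern_response s t m 0) th v =
    signal_factor k gamma * \sum_m w m 0 * cderive (pattern_response s) th v m 0.
  rewrite cderZ; last exact: cdifferentiable_sum.
  rewrite cder_sum //; congr (_ * _); apply: eq_bigr => m _.
  by rewrite cderZ // cderiveE.
have coordE h j : (h *: delta_mx 0 i + gamma) 0 j = h * (j == i)%:R + gamma 0 j.
  by rewrite !mxE.
have coord_ne h j : j != i -> (h *: delta_mx 0 i + gamma) 0 j = gamma 0 j.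
  by rewrite coordE => /negbTE ->; rewrite mulr0 add0r.
have [i2|i2] := ltnP i 2; last first.
  (* Delay, amplitude or phase: the angles stay fixed along the line, so the sum over [m] is a
     constant factor. *)
  transitivity (cder (fun y => (\sum_m w m 0 * pattern_response s th m 0) *
    signal_factor k y) gamma (delta_mx 0 i)).
    by apply: cder_line => h; rewrite mulrC !coord_ne //;
      apply: contraTneq i2 => <-.
  rewrite cderZ; last exact: signal_factor_cdifferentiable.
  by rewrite /z /c (ltnNge i 2) i2 /= mulrC.
(* An angle: now the delay and gain factor is constant, and the line projects to a coordinate line
   of the angle plane. *)
have factorE h : signal_factor k (h *: delta_mx 0 i + gamma) = signal_factor k gamma.
  by rewrite /signal_factor !coord_ne //; apply: contraTneq i2 => <-.
rewrite {}/z {}/c i2 inordK //.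
case: i i2 coordE coord_ne factorE => -[|[|//]] Hi _ coordE coord_ne factorE;
  rewrite -angle; apply: cder_line => h; rewrite factorE; congr (_ * _);
  apply: eq_bigr => m _; congr (_ * pattern_response s _ m 0).
- rewrite coordE coord_ne // mulr1.
  by congr (_, _); rewrite /= ?scaler0 ?add0r ?[h%:A]mulr1.
- rewrite coord_ne // coordE mulr1.
  by congr (_, _); rewrite /= ?scaler0 ?add0r ?[h%:A]mulr1.
Qed.

(** * Fisher information and error bound as functions of the beam covariance *)

(** The family [ws] itself shows that the set in [beams] is inhabited, so the default is not
    returned. *)
Lemma beams_sum (ws : seq 'cV[R[i]]_(Mh * Mv * Q)) :
  let W := \sum_(w <- ws) w *m w ^t* in \sum_(w <- beams W) w *m w ^t* = W.
Proof. by rewrite /beams; case: xgetP => // noW; case: (noW ws). Qed.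

Lemma fim_channelE ws gamma : fim_channel s ws gamma =
  re_gram (2 / noise_var s) ws (fun w i => cderive (signal s w) gamma (delta_mx 0 i)).
Proof. by []. Qed.

(** If no family had sum [W], [beams] would return the empty default, whose information matrix is
    zero and thus singular. *)
Lemma beams_of_unit (eta : 'rV[R]_5) W : FIM s W eta \in unitmx ->
  \sum_(w <- beams W) w *m w ^t* = W.
Proof.
rewrite /FIM /beams; case: xgetP => // _.
suff -> : fim_state s [::] eta = 0 by rewrite unitmxE det0 unitr0.
by rewrite /fim_state fim_channelE re_gram_nil mulmx0 mul0mx.
Qed.

Lemma FIM_sym W (eta : 'rV[R]_5) : (FIM s W eta)^T = FIM s W eta.
Proof. by rewrite /FIM /fim_state !trmx_mul trmxK fim_channelE re_gram_sym mulmxA. Qed.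

Lemma FIM_ge0 W (eta y : 'rV[R]_5) : 0 < noise_var s ->
  0 <= (y *m FIM s W eta *m y^T) 0 0.
Proof.
move=> s0; rewrite /FIM /fim_state fim_channelE.
rewrite -!mulmxA -trmx_mul !mulmxA.
by apply: re_gram_ge0; rewrite divr_ge0 // ltW.
Qed.

Lemma PEB_gt0 W (eta : 'rV[R]_5) : 0 < noise_var s -> FIM s W eta \in unitmx ->
  0 < PEB s W eta.
Proof.
move=> s0 uF.
have diag i : 0 < invmx (FIM s W eta) i i.
  by apply: invmx_diag_gt0 => // [|y]; [exact: FIM_sym | exact: FIM_ge0].
rewrite /PEB /mxtrace big_ord_recl ltr_pwDl //; first by rewrite !mxE.
by apply: sumr_ge0 => i _; rewrite !mxE ltW.
Qed.

(** The map [F] is the Fisher information as a function of the compression [C^H W C]; its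
    homogeneity governs rescaling. Writing the covariance as a sum guarantees that [beams] returns a
    family with that same sum, possibly different from [ws]. *)
Lemma FIM_factor (eta : 'rV[R]_5) :
  is_rotation (bs_rotation s) -> basis_differentiable (pattern_basis s) ->
  differentiable (channel_of_state s) eta ->
  let C := C_w s (departure_angle s eta) in
  exists F : 'M[R[i]]_3 -> 'M[R]_5,
    (forall (t : R) G, F (t%:C *: G) = t *: F G) /\
    forall ws : seq 'cV[R[i]]_(Mh * Mv * Q), FIM s (\sum_(w <- ws) w *m w ^t*) eta =
      F (C ^t* *m (\sum_(w <- ws) w *m w ^t*) *m C).
Proof.
move=> rot db dchan C.
have [el az] := departure_angle_interior _ rot dchan.
have [Z dZ] := cderive_signal _ db el az.
exists (fun G => jacobian (channel_of_state s) eta *m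
  (\matrix_(i, k) (2 / noise_var s * complex.Re (\tr (Z k *m G *m (Z i) ^t*)))) *m
  (jacobian (channel_of_state s) eta)^T).
split => [t G|ws].
  rewrite scalemxAl scalemxAr; congr (_ *m _ *m _).
  apply/matrixP => i k; rewrite !mxE -scalemxAr -scalemxAl mxtraceZ ReM /=.
  by rewrite mul0r subr0; ring.
set W := \sum_(w <- ws) _.
have <- : \sum_(w <- beams W) (C ^t* *m w) *m (C ^t* *m w) ^t* = C ^t* *m W *m C.
  transitivity (C ^t* *m (\sum_(w <- beams W) w *m w ^t*) *m C).
    rewrite mulmx_sumr mulmx_suml; apply: eq_bigr => w _.
    by rewrite adjmxM trmxCK !mulmxA.
  by congr (_ *m _ *m _); exact: beams_sum.
by rewrite /FIM /fim_state fim_channelE (re_gram_factor _ _ _ _ _ _ dZ).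
Qed.

Lemma PEB_scale W W' (eta : 'rV[R]_5) (t : R) :
  t != 0 -> FIM s W eta \in unitmx -> FIM s W' eta = t^-1 *: FIM s W eta ->
  FIM s W' eta \in unitmx /\ PEB s W' eta = t * PEB s W eta.
Proof.
move=> t0 uF FE; have ut : t^-1 \is a GRing.unit by rewrite unitfE invr_eq0.
rewrite /PEB FE; split; first by rewrite unitmxZ.
rewrite invmxZ ?unitmxZ // invrK.
rewrite [ulsubmx _](_ : _ = t *: ulsubmx (invmx (FIM s W eta) : 'M[R]_(3 + 2))).
  by rewrite mxtraceZ.
by apply/matrixP => i j; rewrite !mxE.
Qed.

End Model.

(** * Comparison of an optimal covariance with its projection *)

Lemma psd_sum_gram {R : realType} n (T : Type) (r : seq T) (v : T -> 'cV[R[i]]_n) :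
  psd (\sum_(w <- r) v w *m (v w) ^t*).
Proof.
have adjE (A : 'cV[R[i]]_n) : (A *m A ^t*) ^t* = A *m A ^t* by rewrite adjmxM trmxCK.
split.
  apply/matrixP => i j; rewrite adjmxE !summxE rmorph_sum; apply: eq_bigr => w _.
  by rewrite -[in LHS]adjE adjmxE.
move=> x; rewrite mulmx_sumr mulmx_suml summxE; apply: sumr_ge0 => w _.
have := trmx_gram_ge0 _ _ (x ^t* *m v w).
by rewrite trace_mx11 adjmxM trmxCK !mulmxA.
Qed.

Theorem proposition1 (R : realType) (Mh Mv Q Ns : nat)
    (s : system R Mh Mv Q Ns) (eta : 'rV[R]_5) (W : 'M[R[i]]_(Mh * Mv * Q)) :
  (0 < Mh)%N -> (0 < Mv)%N -> (0 < Q)%N -> (0 < Ns)%N ->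
  0 < spacing s -> 0 < wavelength s -> 0 < subcarrier_spacing s ->
  0 < power s -> 0 < noise_var s -> 0 < light_speed s ->
  is_rotation (bs_rotation s) ->
  basis_differentiable (pattern_basis s) ->
  basis_orthonormal (pattern_basis s) ->
  0 < eta 0 3 ->
  differentiable (channel_of_state s) eta ->
  optimal s eta W ->
  exists Xi : 'M[R[i]]_3,
    psd Xi /\
    W = C_w s (departure_angle s eta) *m Xi *m
          (C_w s (departure_angle s eta)) ^t*.
Proof.
move=> _ _ _ _ _ _ _ _ s0 _ rot db _ _ dchan [[psdW trW uW] optW].
set C := C_w s (departure_angle s eta).
have [F [FZ FIM_F]] := FIM_factor _ _ rot db dchan.
(* Homogeneity at [t = 0]; this later excludes a vanishing projected part. *)
have F0 : F 0 = 0 by have := FZ 0 0; rewrite scaler0 scale0r.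
have /choice[x] : forall w : 'cV[R[i]]_(Mh * Mv * Q), exists x : 'cV[R[i]]_3,
    exists y, w = C *m x + y /\ C ^t* *m y = 0.
  by move=> w; exact: orthogonal_decomposition.
move=> /choice[y wyE].
have wE w : w = C *m x w + y w by have [] := wyE w.
have Cy w : C ^t* *m y w = 0 by have [] := wyE w.
have yC w : (y w) ^t* *m C = 0.
  by rewrite -[C]trmxCK -adjmxM Cy trmx0 map_mx0.
pose ws := beams W; have wsW : \sum_(w <- ws) w *m w ^t* = W := beams_of_unit _ _ _ uW.
(* [Xi] is the matrix to be exhibited, and [W0] the covariance of the projected beams [C x]. *)
pose Xi := \sum_(w <- ws) x w *m (x w) ^t*.
pose W0 := C *m Xi *m C ^t*.
have W0E : W0 = \sum_(w <- ws) (C *m x w) *m (C *m x w) ^t*.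
  rewrite /W0 mulmx_sumr mulmx_suml; apply: eq_bigr => w _.
  by rewrite adjmxM !mulmxA.
have GE : C ^t* *m W *m C = C ^t* *m W0 *m C.
  rewrite W0E -wsW !mulmx_sumr !mulmx_suml; apply: eq_bigr => w _.
  have Cw : C ^t* *m w = C ^t* *m (C *m x w).
    by rewrite {1}[w]wE mulmxDr Cy addr0.
  have wC : w ^t* *m C = (C *m x w) ^t* *m C.
    by rewrite -[C in LHS]trmxCK -adjmxM Cw adjmxM trmxCK.
  by rewrite -!(mulmxA (C ^t*)) -!(mulmxA _ _ C) wC !mulmxA -(mulmxA _ C) Cw !mulmxA.
(* [Y] is the power spent orthogonally to the columns of [C]; the cross terms have trace zero, so
   the powers add up to [1]. *)
pose Y := \sum_(w <- ws) \tr (y w *m (y w) ^t*).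
have trE : \tr W0 + Y = 1.
  rewrite -trW -wsW W0E ![\tr (\sum_(w <- ws) _)]raddf_sum -big_split /=.
  apply: eq_bigr => w _; rewrite [in RHS](wE w).
  have adjD (A B : 'cV[R[i]]_(Mh * Mv * Q)) : (A + B) ^t* = A ^t* + B ^t*.
    by apply/matrixP => i j; rewrite !mxE rmorphD.
  rewrite adjD mulmxDl !mulmxDr !mxtraceD.
  have -> : \tr (C *m x w *m (y w) ^t*) = 0.
    by rewrite mxtrace_mulC mulmxA yC mul0mx mxtrace0.
  have -> : \tr (y w *m (C *m x w) ^t*) = 0.
    by rewrite mxtrace_mulC adjmxM -mulmxA Cy mulmx0 mxtrace0.
  by rewrite addr0 add0r.
have Y0 : 0 <= Y by apply: sumr_ge0 => w _; exact: trmx_gram_ge0.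
have W00 : 0 <= \tr W0.
  rewrite W0E raddf_sum; apply: sumr_ge0 => w _; exact: trmx_gram_ge0.
(* If [Y] vanishes, so does each of its nonnegative terms, hence every beam equals its projection.
   The other case contradicts optimality. *)
have [Yeq0|Yn0] := eqVneq Y 0.
  exists Xi; split; first exact: psd_sum_gram.
  rewrite -/C -/W0 W0E -wsW; apply: eq_big_seq => w ws_w.
  suff y0 : y w = 0 by rewrite [in LHS](wE w) y0 addr0.
  apply: trmx_gram_eq0; apply/eqP; rewrite eq_le trmx_gram_ge0 andbT -Yeq0 /Y.
  rewrite (big_rem w) //= lerDl; apply: sumr_ge0 => ? _; exact: trmx_gram_ge0.
pose t := complex.Re (\tr W0).
have tE : \tr W0 = t%:C by rewrite /t RRe_real // ger0_real.
have t_lt1 : t < 1.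
  have := trE; rewrite tE => /(congr1 (@complex.Re R)); rewrite raddfD /= => <-.
  by move: Y0 Yn0; rewrite le0r => /orP[-> //|+ _]; rewrite ltcE => /andP[_]; rewrite ltrDl.
have t_gt0 : 0 < t.
  (* For [t = 0] all projected beams vanish, so the information at [W] would be [F 0 = 0], against
     invertibility. *)
  move: W00; rewrite tE lecR le0r => /orP[/eqP t0|//].
  have W0_0 : W0 = 0.
    rewrite W0E big_seq big1 // => w ws_w.
    suff -> : C *m x w = 0 by rewrite mul0mx.
    apply: trmx_gram_eq0; apply/eqP; rewrite eq_le trmx_gram_ge0 andbT.
    have <- : \tr W0 = 0 by rewrite tE t0.
    rewrite W0E raddf_sum (big_rem w) //= lerDl; apply: sumr_ge0 => ? _; exact: trmx_gram_ge0.
  have := uW; rewrite -wsW FIM_F wsW GE W0_0 mulmx0 mul0mx F0.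
  by rewrite unitmxE det0 unitr0.
(* Scaling beams by the square root of [1 / t] scales their covariance by [1 / t]. The competitor is
   built from explicit beams so that [FIM_factor] applies to it. *)
pose r : R[i] := (Num.sqrt t^-1)%:C.
pose ws' := [seq r *: (C *m x w) | w <- ws].
pose W' := \sum_(w <- ws') w *m w ^t*.
have W'E : W' = (t^-1)%:C *: W0.
  rewrite /W' big_map W0E scaler_sumr; apply: eq_bigr => w _.
  have -> : (r *: (C *m x w)) ^t* = r *: (C *m x w) ^t*.
    apply/matrixP => i j; rewrite !mxE rmorphM; congr (_ * _).
    by apply: conj_Creal; apply/complex_realP; exists (Num.sqrt t^-1).
  rewrite -scalemxAl -scalemxAr scalerA -rmorphM /=.
  by rewrite -expr2 sqr_sqrtr // invr_ge0 ltW.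
have FIM_W' : FIM s W' eta = t^-1 *: FIM s W eta.
  by rewrite FIM_F -/W' W'E -scalemxAr -scalemxAl FZ -GE -{2}wsW FIM_F wsW.
have [uW' PEB_W'] := PEB_scale _ _ _ _ _ (lt0r_neq0 t_gt0) uW FIM_W'.
have feasW' : feasible s eta W'.
  split => //; first exact: psd_sum_gram.
  by rewrite W'E mxtraceZ tE -rmorphM /= mulVf ?lt0r_neq0.
(* The competitor has error bound [t * PEB W], strictly below [PEB W] because [t < 1] and the bound
   is positive. *)
have := optW W' feasW'; rewrite PEB_W' leNgt => /negP[].
by rewrite gtr_pMl // PEB_gt0.
Qed.
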